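(* Let $T$ and $V$ be oriented non-equilateral triangles. Then $T$ and $V$ have the same Brocard angle if and only if there exist a nonnegative integer $n_0$ and $\rho,\xi\in\mathbb R\cup\{\infty\}$ such that $\mathcal C_\rho\bigl(\mathcal C_\xi^{2n_0}(T)\bigr)$ is directly congruent to $V$.
   Context: An oriented triangle $T=ABC$ is a (nondegenerate) triangle whose vertices are labelled counterclockwise; it is written as the ordered triple $T=(a,b,c)$ of its side lengths $a=BC$, $b=CA$, $c=AB$ (positive reals with $|a-b|<c<a+b$). Oriented triangles $(a,b,c)$ and $(x,y,z)$ are directly congruent if $(x,y,z)$ is one of $(a,b,c),(b,c,a),(c,a,b)$. The Brocard angle of $ABC$ is the common value $\omega$ of the angles $PAB=PBC=PCA$, where $P$ is the unique point for which these three angles are equal. Ceva's operators: for $\rho\in\mathbb R$, $\mathcal C_\rho(a,b,c)=(x_\rho,y_\rho,z_\rho)$ with $x_\rho=\sqrt{\rho a^2+(1-\rho)b^2+\rho(\rho-1)c^2}$, $y_\rho=\sqrt{(1-\rho)a^2+\rho(\rho-1)b^2+\rho c^2}$, $z_\rho=\sqrt{\rho(\rho-1)a^2+\rho b^2+(1-\rho)c^2}$ (these are the lengths of the cevians $CC_\rho,BB_\rho,AA_\rho$ where $\overrightarrow{AC_\rho}=\rho\overrightarrow{AB}$, $\overrightarrow{CB_\rho}=\rho\overrightarrow{CA}$, $\overrightarrow{BA_\rho}=\rho\overrightarrow{BC}$, and they are again the side lengths of an oriented triangle), and $\mathcal C_\infty(a,b,c)=(c,b,a)$. $\mathcal C_\xi^{n}$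 denotes the $n$-fold composition of $\mathcal C_\xi$ with itself, with $\mathcal C_\xi^0$ the identity. *)

(* Defs.v *)
From Stdlib Require Import Reals.
Open Scope R_scope.

(* The ordered side lengths (a, b, c) = (BC, CA, AB) of a triangle ABC whose
   vertices are labelled counterclockwise. *)
Definition triple : Type := (R * R * R)%type.

Definition oriented_triangle (T : triple) : Prop :=
  let '(a, b, c) := T in
  0 < a /\ 0 < b /\ 0 < c /\ Rabs (a - b) < c /\ c < a + b.

Definition equilateral (T : triple) : Prop :=
  let '(a, b, c) := T in a = b /\ b = c.

Definition directly_congruent (T V : triple) : Prop :=
  let '(a, b, c) := T in
  V = (a, b, c) \/ V = (b, c, a) \/ V = (c, a, b).

Definition point : Type := (R * R)%type.

Definition dist_pt (P Q : point) : R :=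
  dist_euc (fst P) (snd P) (fst Q) (snd Q).

(* Twice the signed area of PQS, positive iff P, Q, S are counterclockwise. *)
Definition orient (P Q S : point) : R :=
  (fst Q - fst P) * (snd S - snd P) - (snd Q - snd P) * (fst S - fst P).

(* The unsigned angle PQS, with vertex Q. *)
Definition angle (P Q S : point) : R :=
  acos (((fst P - fst Q) * (fst S - fst Q) + (snd P - snd Q) * (snd S - snd Q))
        / (dist_pt P Q * dist_pt S Q)).

Definition realizes (A B C : point) (T : triple) : Prop :=
  0 < orient A B C /\ T = (dist_pt B C, dist_pt C A, dist_pt A B).

Definition inside (P A B C : point) : Prop :=
  0 < orient A B P /\ 0 < orient B C P /\ 0 < orient C A P.

(* The Brocard point is taken inside the triangle: for unsigned angles,
   PAB = PBC = PCA can also have solutions P outside some triangles. *)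
Definition is_brocard_angle (T : triple) (w : R) : Prop :=
  exists A B C P : point,
    realizes A B C T /\ inside P A B C /\
    angle P A B = w /\ angle P B C = w /\ angle P C A = w.

Definition same_brocard_angle (T V : triple) : Prop :=
  exists w : R, is_brocard_angle T w /\ is_brocard_angle V w.

(* The real line with a single point at infinity. *)
Inductive real_or_infty : Type :=
| Real (r : R)
| Infty.

Definition ceva (p : real_or_infty) (T : triple) : triple :=
  let '(a, b, c) := T in
  match p with
  | Real r =>
      (sqrt (r * a ^ 2 + (1 - r) * b ^ 2 + r * (r - 1) * c ^ 2),
       sqrt ((1 - r) * a ^ 2 + r * (r - 1) * b ^ 2 + r * c ^ 2),
       sqrt (r * (r - 1) * a ^ 2 + r * b ^ 2 + (1 - r) * c ^ 2))
  | Infty => (c, b, a)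
  end.

(* Main.v *)
Require Import Defs.
From Stdlib Require Import Reals Lra Lia Psatz.
Open Scope R_scope.

(** Both conditions only see the squares [(A, B, C)] of the side lengths.

    The Brocard angle [w] of a triangle of area [D] satisfies
    [cot w = (A + B + C) / (4 D)].  For the necessity of this formula, write
    the equality of the three angles as [AB.AP = k * (AB x AP)] and its two
    cyclic images, with [k = cot w], and add them up: the scalar products add
    up to [(A + B + C) / 2] and the cross products to [2 D], wherever [P] is.
    For the existence of the angle, take the point with barycentric
    coordinates [(A C : A B : B C)].  This is [is_brocard_angle_iff].

    Ceva's operators act linearly on the squares.  Put
    [psi = A + omega B + omega^2 C] with [omega] a primitive cube root of
    unity, [S = A + B + C] and [q = r^2 - r + 1 = (r + omega)(r + omega^2)].
    The operator of parameter [r] maps [S] to [q S], and [psi] to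
    [omega^2 (r + omega)^2] times the conjugate of [psi].  The factor has
    modulus [q], and [16 D^2 = (S^2 - 4 |psi|^2) / 3], which gives three facts:
    - the ratio [|psi| / S], hence the Brocard angle, is preserved
      ([brocard_cot_ceva]);
    - the operator applied twice is the homothety of ratio [q]
      ([ceva_twice]), and since [q] takes every value in [[3/4, oo)], the even
      iterates realize all homotheties ([positive_is_gain_pow]);
    - the phase of the factor is that of
      [omega^2 (r + omega) / (r + omega^2)], a Moebius function of [r] that
      maps the projective line onto the unit circle, so that one application
      reaches every shape of the same ratio [|psi| / S] ([ceva_reaches_shape]).
    A homothety followed by one operator therefore reaches every triangle with
    the same Brocard angle.  The proofs below use only the real form of these
    identities. *)

(** * Squared side lengths *)

Definition sum_squares (T : triple) : R :=
  let '(a, b, c) := T in a ^ 2 + b ^ 2 + c ^ 2.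

(** Heron's formula: sixteen times the squared area. *)
Definition heron (T : triple) : R :=
  let '(a, b, c) := T in
  2 * (a ^ 2 * b ^ 2 + b ^ 2 * c ^ 2 + c ^ 2 * a ^ 2)
  - (a ^ 4 + b ^ 4 + c ^ 4).

Definition positive (T : triple) : Prop :=
  let '(a, b, c) := T in 0 < a /\ 0 < b /\ 0 < c.

(** The working form of [oriented_triangle]: Heron's polynomial transforms
    well under Ceva's operators, the triangle inequalities do not. *)
Definition triangle (T : triple) : Prop := positive T /\ 0 < heron T.

Definition scale (k : R) (T : triple) : triple :=
  let '(a, b, c) := T in (k * a, k * b, k * c).

Definition brocard_cot (T : triple) : R := sum_squares T / sqrt (heron T).

Lemma oriented_triangle_triangle (T : triple) :
  oriented_triangle T -> triangle T.
Proof.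
  destruct T as [[a b] c]; unfold oriented_triangle, triangle, positive, heron.
  intros (Ha & Hb & Hc & Habs & Hsum).
  apply Rabs_def2 in Habs.
  split; [tauto|].
  replace (_ - _) with ((a + b + c) * (a + b - c) * ((c - (a - b)) * (c + (a - b))))
    by ring.
  repeat apply Rmult_lt_0_compat; lra.
Qed.

Lemma sum_squares_pos (T : triple) : triangle T -> 0 < sum_squares T.
Proof.
  destruct T as [[a b] c]; unfold triangle, positive, sum_squares.
  intros ((Ha & Hb & Hc) & _); nra.
Qed.

Lemma triangle_scale (k : R) (T : triple) :
  0 < k -> triangle T -> triangle (scale k T).
Proof.
  intros Hk; destruct T as [[a b] c]; unfold triangle, positive, heron; simpl scale.
  intros ((Ha & Hb & Hc) & HH); cbv iota beta.
  split; [repeat split; apply Rmult_lt_0_compat; assumption|].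
  replace (_ - _) with (k ^ 4 * (2 * (a ^ 2 * b ^ 2 + b ^ 2 * c ^ 2 + c ^ 2 * a ^ 2)
                                - (a ^ 4 + b ^ 4 + c ^ 4))) by ring.
  apply Rmult_lt_0_compat; [apply pow_lt|]; assumption.
Qed.

Lemma scale_scale (k l : R) (T : triple) : scale k (scale l T) = scale (k * l) T.
Proof. destruct T as [[a b] c]; simpl; now rewrite !Rmult_assoc. Qed.

Lemma scale_1 (T : triple) : scale 1 T = T.
Proof. destruct T as [[a b] c]; simpl; now rewrite !Rmult_1_l. Qed.

(** * The Brocard angle in terms of the side lengths *)

Definition dot (P Q S : point) : R :=
  (fst P - fst Q) * (fst S - fst Q) + (snd P - snd Q) * (snd S - snd Q).

Lemma dist_pt_sqr (P Q : point) :
  dist_pt P Q ^ 2 = (fst P - fst Q) ^ 2 + (snd P - snd Q) ^ 2.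
Proof.
  unfold dist_pt, dist_euc.
  rewrite pow2_sqrt; [unfold Rsqr; ring|].
  apply Rplus_le_le_0_compat; apply Rle_0_sqr.
Qed.

Lemma dist_pt_nonneg (P Q : point) : 0 <= dist_pt P Q.
Proof. apply sqrt_pos. Qed.

(** The arccotangent of the quotient of the scalar and the cross product: by
    Lagrange's identity their squares add up to the squared product of the two
    distances, so that the cosine determines this quotient as soon as the
    cross product is positive. *)
Lemma angle_arccot (P Q S : point) :
  0 < orient Q S P ->
  angle P Q S = PI / 2 - atan (dot P Q S / orient Q S P).
Proof.
  intros Ho.
  set (o := orient Q S P) in *; set (d := dot P Q S).
  set (p := dist_pt P Q * dist_pt S Q).
  assert (Hlagrange : p ^ 2 = d ^ 2 + o ^ 2).
  { unfold p; rewrite Rpow_mult_distr, !dist_pt_sqr.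
    unfold d, o, dot, orient; ring. }
  assert (Hp : 0 < p).
  { assert (0 <= p) by (apply Rmult_le_pos; apply dist_pt_nonneg); nra. }
  assert (Hcos : -1 < d / p < 1).
  { split; apply Rmult_lt_reg_r with p; try assumption;
      unfold Rdiv; rewrite Rmult_assoc, Rinv_l by lra; nra. }
  assert (Hsin : sqrt (1 - (d / p)²) = o / p).
  { apply sqrt_lem_1.
    - unfold Rsqr; nra.
    - apply Rlt_le, Rdiv_lt_0_compat; assumption.
    - unfold Rsqr.
      replace (o / p * (o / p)) with (o ^ 2 / p ^ 2) by (field; lra).
      replace (o ^ 2) with (p ^ 2 - d ^ 2) by lra.
      field; lra. }
  change (angle P Q S) with (acos (d / p)).
  rewrite acos_asin, asin_atan, Hsin by lra.
  do 2 f_equal.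
  field; split; lra.
Qed.

Lemma atan_injective (x y : R) : atan x = atan y -> x = y.
Proof. intros H; rewrite <- (tan_atan x), <- (tan_atan y), H; reflexivity. Qed.

Lemma brocard_cot_realizes (A B C : point) (T : triple) :
  realizes A B C T ->
  brocard_cot T =
  (dist_pt B C ^ 2 + dist_pt C A ^ 2 + dist_pt A B ^ 2) / (2 * orient A B C).
Proof.
  intros (Ho & ->); unfold brocard_cot, sum_squares.
  f_equal; apply sqrt_lem_1; [| lra |].
  all: assert (HH : heron (dist_pt B C, dist_pt C A, dist_pt A B)
                    = (2 * orient A B C) ^ 2).
  1, 3: unfold heron;
    replace (dist_pt B C ^ 4) with ((dist_pt B C ^ 2) ^ 2) by ring;
    replace (dist_pt C A ^ 4) with ((dist_pt C A ^ 2) ^ 2) by ring;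
    replace (dist_pt A B ^ 4) with ((dist_pt A B ^ 2) ^ 2) by ring;
    rewrite !dist_pt_sqr; unfold orient; ring.
  all: rewrite HH; nra.
Qed.

(** Adding the three equations [dot = cot w * orient] eliminates [P]:
    the scalar products add up to half of [sum_squares T], the areas to that of
    the triangle. *)
Lemma is_brocard_angle_unique (T : triple) (w : R) :
  is_brocard_angle T w -> w = PI / 2 - atan (brocard_cot T).
Proof.
  intros (A & B & C & P & HT & (H1 & H2 & H3) & E1 & E2 & E3).
  rewrite (brocard_cot_realizes A B C T HT); destruct HT as [Ho _].
  rewrite angle_arccot in E1, E2, E3 by assumption.
  set (k := dot P A B / orient A B P) in *.
  assert (D1 : dot P A B = k * orient A B P) by (unfold k; field; lra).
  assert (D2 : dot P B C = k * orient B C P).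
  { replace k with (dot P B C / orient B C P); [field; lra|].
    apply atan_injective; lra. }
  assert (D3 : dot P C A = k * orient C A P).
  { replace k with (dot P C A / orient C A P); [field; lra|].
    apply atan_injective; lra. }
  assert (Hdot : dist_pt B C ^ 2 + dist_pt C A ^ 2 + dist_pt A B ^ 2
                 = 2 * (dot P A B + dot P B C + dot P C A))
    by (rewrite !dist_pt_sqr; unfold dot; ring).
  assert (Hcross : orient A B P + orient B C P + orient C A P = orient A B C)
    by (unfold orient; ring).
  rewrite Hdot, D1, D2, D3.
  replace (2 * _ / _) with k; [lra|].
  rewrite <- Hcross; field; lra.
Qed.

Lemma triangle_realizable (T : triple) :
  triangle T -> exists A B C, realizes A B C T.
Proof.
  destruct T as [[a b] c]; unfold triangle, positive.
  intros ((Ha & Hb & Hc) & HH).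
  set (h := sqrt (heron (a, b, c))).
  assert (Hh : 0 < h) by (apply sqrt_lt_R0, HH).
  assert (Hh2 : h * h = heron (a, b, c)) by (apply sqrt_sqrt; lra).
  (* The altitude through the third vertex is [2 D / c], where [h = 4 D]. *)
  exists (0, 0), (c, 0), ((b ^ 2 + c ^ 2 - a ^ 2) / (2 * c), h / (2 * c)).
  split.
  - unfold orient; simpl fst; simpl snd.
    replace (_ - _) with (h / 2) by (field; lra); lra.
  - unfold dist_pt, dist_euc; simpl fst; simpl snd.
    f_equal; [f_equal|]; symmetry;
      (apply sqrt_lem_1;
       [apply Rplus_le_le_0_compat; apply Rle_0_sqr|lra|unfold Rsqr]).
    + replace ((0 - h / (2 * c)) * (0 - h / (2 * c))) with (h * h / (4 * c ^ 2))
        by (field; lra).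
      rewrite Hh2; unfold heron; field; lra.
    + replace ((h / (2 * c) - 0) * (h / (2 * c) - 0)) with (h * h / (4 * c ^ 2))
        by (field; lra).
      rewrite Hh2; unfold heron; field; lra.
    + ring.
Qed.

(** The first Brocard point has barycentric coordinates
    [a^2 c^2 : a^2 b^2 : b^2 c^2].  The area of [ABP] is then proportional to
    [b^2 c^2], and so is [AB.AP] by the law of cosines for the angle at [A];
    the quotient is symmetric in [a], [b], [c]. *)
Lemma brocard_point_exists (A B C : point) :
  0 < orient A B C ->
  0 < dist_pt B C -> 0 < dist_pt C A -> 0 < dist_pt A B ->
  exists P, inside P A B C /\
    let k := (dist_pt B C ^ 2 + dist_pt C A ^ 2 + dist_pt A B ^ 2)
             / (2 * orient A B C) in
    dot P A B / orient A B P = k /\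
    dot P B C / orient B C P = k /\
    dot P C A / orient C A P = k.
Proof.
  intros Ho Ha Hb Hc.
  assert (Ha2 := dist_pt_sqr B C); assert (Hb2 := dist_pt_sqr C A);
    assert (Hc2 := dist_pt_sqr A B).
  apply (pow_lt _ 2) in Ha, Hb, Hc.
  set (a2 := dist_pt B C ^ 2) in *; set (b2 := dist_pt C A ^ 2) in *;
    set (c2 := dist_pt A B ^ 2) in *; clearbody a2 b2 c2.
  set (s := a2 * c2 + a2 * b2 + b2 * c2).
  assert (Hac := Rmult_lt_0_compat _ _ Ha Hc).
  assert (Hab := Rmult_lt_0_compat _ _ Ha Hb).
  assert (Hbc := Rmult_lt_0_compat _ _ Hb Hc).
  assert (Hs : 0 < s) by (unfold s; lra).
  set (P := ((a2 * c2 * fst A + a2 * b2 * fst B + b2 * c2 * fst C) / s,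
             (a2 * c2 * snd A + a2 * b2 * snd B + b2 * c2 * snd C) / s) : point).
  assert (OA : orient A B P = b2 * c2 / s * orient A B C)
    by (unfold orient, P; simpl fst; simpl snd; unfold s; field; fold s; lra).
  assert (OB : orient B C P = a2 * c2 / s * orient A B C)
    by (unfold orient, P; simpl fst; simpl snd; unfold s; field; fold s; lra).
  assert (OC : orient C A P = a2 * b2 / s * orient A B C)
    by (unfold orient, P; simpl fst; simpl snd; unfold s; field; fold s; lra).
  assert (DA : dot P A B = b2 * c2 / s * ((a2 + b2 + c2) / 2)).
  { replace (dot P A B)
      with ((a2 * b2 * ((fst A - fst B) ^ 2 + (snd A - snd B) ^ 2)
             + b2 * c2 * dot B A C) / s)
      by (unfold dot, P; simpl fst; simpl snd; unfold s; field; fold s; lra).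
    replace (dot B A C) with ((b2 + c2 - a2) / 2)
      by (rewrite Ha2, Hb2, Hc2; unfold dot; field).
    rewrite <- Hc2; field; lra. }
  assert (DB : dot P B C = a2 * c2 / s * ((a2 + b2 + c2) / 2)).
  { replace (dot P B C)
      with ((b2 * c2 * ((fst B - fst C) ^ 2 + (snd B - snd C) ^ 2)
             + a2 * c2 * dot C B A) / s)
      by (unfold dot, P; simpl fst; simpl snd; unfold s; field; fold s; lra).
    replace (dot C B A) with ((a2 + c2 - b2) / 2)
      by (rewrite Ha2, Hb2, Hc2; unfold dot; field).
    rewrite <- Ha2; field; lra. }
  assert (DC : dot P C A = a2 * b2 / s * ((a2 + b2 + c2) / 2)).
  { replace (dot P C A)
      with ((a2 * c2 * ((fst C - fst A) ^ 2 + (snd C - snd A) ^ 2)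
             + a2 * b2 * dot A C B) / s)
      by (unfold dot, P; simpl fst; simpl snd; unfold s; field; fold s; lra).
    replace (dot A C B) with ((a2 + b2 - c2) / 2)
      by (rewrite Ha2, Hb2, Hc2; unfold dot; field).
    rewrite <- Hb2; field; lra. }
  exists P; split.
  - unfold inside; rewrite OA, OB, OC.
    repeat split; apply Rmult_lt_0_compat; try assumption;
      apply Rdiv_lt_0_compat; assumption.
  - cbv zeta; rewrite OA, OB, OC, DA, DB, DC.
    repeat split; field; repeat split; lra.
Qed.

Lemma is_brocard_angle_iff (T : triple) (w : R) :
  triangle T ->
  (is_brocard_angle T w <-> w = PI / 2 - atan (brocard_cot T)).
Proof.
  intros HT; split; [apply is_brocard_angle_unique|intros ->].
  destruct (triangle_realizable T HT) as (A & B & C & HR).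
  rewrite (brocard_cot_realizes _ _ _ _ HR).
  assert (HR' := HR); destruct HR' as (Ho & ->).
  destruct HT as ((Ha & Hb & Hc) & _).
  destruct (brocard_point_exists A B C Ho Ha Hb Hc) as (P & Hin & E1 & E2 & E3).
  assert (Hin' := Hin); destruct Hin' as (H1 & H2 & H3).
  exists A, B, C, P; split; [exact HR|split; [exact Hin|]].
  rewrite !angle_arccot, E1, E2, E3 by assumption; auto.
Qed.

Lemma same_brocard_angle_iff (T V : triple) :
  triangle T -> triangle V ->
  (same_brocard_angle T V <-> brocard_cot T = brocard_cot V).
Proof.
  intros HT HV; split.
  - intros (w & Hw1 & Hw2).
    apply is_brocard_angle_unique in Hw1, Hw2.
    apply atan_injective; lra.
  - intros E; exists (PI / 2 - atan (brocard_cot T)).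
    split; apply is_brocard_angle_iff; congruence.
Qed.

(** * Ceva's operators on the squares *)

(** The common factor of [S], [|psi|] and the area under [ceva p]. *)
Definition gain (p : real_or_infty) : R :=
  match p with Real r => r ^ 2 - r + 1 | Infty => 1 end.

Lemma gain_pos (p : real_or_infty) : 0 < gain p.
Proof. destruct p as [r|]; simpl; nra. Qed.

(** Stewart's formula makes the squared cevian a quadratic polynomial in [r]
    of discriminant [-16 D^2] and leading coefficient [c^2]. *)
Lemma cevian_square_pos (a b c r : R) :
  0 < c -> 0 < heron (a, b, c) ->
  0 < r * a ^ 2 + (1 - r) * b ^ 2 + r * (r - 1) * c ^ 2.
Proof.
  intros Hc HH.
  apply Rmult_lt_reg_l with (4 * c ^ 2); [nra|].
  rewrite Rmult_0_r.
  replace (_ * _) with ((2 * c ^ 2 * r + (a ^ 2 - b ^ 2 - c ^ 2)) ^ 2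
                        + heron (a, b, c)) by (unfold heron; ring).
  apply Rplus_le_lt_0_compat; [apply pow2_ge_0|assumption].
Qed.

Lemma ceva_real_squares (r a b c : R) :
  triangle (a, b, c) ->
  exists x y z, ceva (Real r) (a, b, c) = (x, y, z) /\ positive (x, y, z) /\
    x ^ 2 = r * a ^ 2 + (1 - r) * b ^ 2 + r * (r - 1) * c ^ 2 /\
    y ^ 2 = (1 - r) * a ^ 2 + r * (r - 1) * b ^ 2 + r * c ^ 2 /\
    z ^ 2 = r * (r - 1) * a ^ 2 + r * b ^ 2 + (1 - r) * c ^ 2.
Proof.
  intros ((Ha & Hb & Hc) & HH).
  assert (Hx := cevian_square_pos a b c r Hc HH).
  assert (Hy : 0 < (1 - r) * a ^ 2 + r * (r - 1) * b ^ 2 + r * c ^ 2).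
  { replace (_ + _ + _)
      with (r * c ^ 2 + (1 - r) * a ^ 2 + r * (r - 1) * b ^ 2) by ring.
    apply cevian_square_pos; [assumption|].
    replace (heron _) with (heron (a, b, c)) by (unfold heron; ring); assumption. }
  assert (Hz : 0 < r * (r - 1) * a ^ 2 + r * b ^ 2 + (1 - r) * c ^ 2).
  { replace (_ + _ + _)
      with (r * b ^ 2 + (1 - r) * c ^ 2 + r * (r - 1) * a ^ 2) by ring.
    apply cevian_square_pos; [assumption|].
    replace (heron _) with (heron (a, b, c)) by (unfold heron; ring); assumption. }
  do 3 eexists; split; [reflexivity|].
  split; [repeat split; apply sqrt_lt_R0; assumption|].
  rewrite !pow2_sqrt by lra; auto.
Qed.

Lemma heron_sqr (a b c : R) :
  heron (a, b, c) =
  2 * (a ^ 2 * b ^ 2 + b ^ 2 * c ^ 2 + c ^ 2 * a ^ 2)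
  - ((a ^ 2) ^ 2 + (b ^ 2) ^ 2 + (c ^ 2) ^ 2).
Proof. unfold heron; ring. Qed.

Lemma sum_squares_ceva (p : real_or_infty) (T : triple) :
  triangle T -> sum_squares (ceva p T) = gain p * sum_squares T.
Proof.
  destruct T as [[a b] c]; intros HT; destruct p as [r|]; [|simpl; ring].
  destruct (ceva_real_squares r a b c HT) as (x & y & z & E & _ & Hx & Hy & Hz).
  rewrite E; unfold sum_squares, gain; rewrite Hx, Hy, Hz; ring.
Qed.

Lemma heron_ceva (p : real_or_infty) (T : triple) :
  triangle T -> heron (ceva p T) = gain p ^ 2 * heron T.
Proof.
  destruct T as [[a b] c]; intros HT; destruct p as [r|];
    [|unfold heron; simpl ceva; cbv iota beta; unfold gain; ring].
  destruct (ceva_real_squares r a b c HT) as (x & y & z & E & _ & Hx & Hy & Hz).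
  rewrite E, !heron_sqr, Hx, Hy, Hz; unfold gain; ring.
Qed.

Lemma triangle_ceva (p : real_or_infty) (T : triple) :
  triangle T -> triangle (ceva p T).
Proof.
  intros HT; split.
  - destruct T as [[a b] c], p as [r|].
    + destruct (ceva_real_squares r a b c HT) as (x & y & z & -> & H & _).
      exact H.
    + destruct HT as [H _]; unfold positive in *; simpl; tauto.
  - rewrite heron_ceva by assumption.
    apply Rmult_lt_0_compat; [apply pow_lt, gain_pos|apply HT].
Qed.

(** The cotangent is a function of the ratio [|psi| / S], and the operators
    multiply [S] and [|psi|] by the same factor. *)
Lemma brocard_cot_ceva (p : real_or_infty) (T : triple) :
  triangle T -> brocard_cot (ceva p T) = brocard_cot T.
Proof.
  intros HT; unfold brocard_cot.
  rewrite sum_squares_ceva, heron_ceva by assumption.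
  assert (Hg := gain_pos p); destruct HT as [_ HH].
  rewrite sqrt_mult, sqrt_pow2; [|lra|nra|lra].
  apply sqrt_lt_R0 in HH.
  field; lra.
Qed.

Lemma brocard_cot_directly_congruent (T V : triple) :
  directly_congruent T V -> brocard_cot V = brocard_cot T.
Proof.
  destruct T as [[a b] c]; intros [-> | [-> | ->]]; [reflexivity| |];
    unfold brocard_cot; f_equal; try (simpl; ring);
    f_equal; unfold heron; ring.
Qed.

Lemma iter_ceva_invariant (n : nat) (p : real_or_infty) (T : triple) :
  triangle T ->
  triangle (Nat.iter n (ceva p) T) /\
  brocard_cot (Nat.iter n (ceva p) T) = brocard_cot T.
Proof.
  intros HT; induction n as [|n [IH1 IH2]]; simpl; [auto|].
  rewrite brocard_cot_ceva by assumption.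
  split; [apply triangle_ceva|]; assumption.
Qed.

(** * Homotheties *)

(** The operator multiplies the conjugate of [psi] by a factor of modulus
    [gain p], so that its square multiplies [psi], just as [S], by
    [gain p ^ 2]; the lengths are multiplied by [gain p]. *)
Lemma ceva_twice (p : real_or_infty) (T : triple) :
  triangle T -> ceva p (ceva p T) = scale (gain p) T.
Proof.
  intros HT; assert (HT' := triangle_ceva p T HT).
  destruct T as [[a b] c], p as [r|];
    [|unfold gain; rewrite scale_1; reflexivity].
  destruct (ceva_real_squares r a b c HT) as (x & y & z & E & _ & Hx & Hy & Hz).
  rewrite E in *; destruct HT as ((Ha & Hb & Hc) & _).
  assert (Hg : 0 < gain (Real r)) by apply gain_pos.
  assert (Hroot : forall u s, 0 < s -> u = (gain (Real r) * s) ^ 2 ->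
                    sqrt u = gain (Real r) * s).
  { intros u s Hs ->; apply sqrt_pow2; nra. }
  simpl scale; unfold ceva; rewrite Hx, Hy, Hz.
  rewrite (Hroot _ a), (Hroot _ b), (Hroot _ c); try reflexivity;
    try assumption; unfold gain; ring.
Qed.

Lemma ceva_scale (p : real_or_infty) (k : R) (T : triple) :
  0 < k -> ceva p (scale k T) = scale k (ceva p T).
Proof.
  intros Hk; destruct T as [[a b] c], p as [r|]; [|reflexivity].
  assert (Hroot : forall u v, u = k ^ 2 * v -> sqrt u = k * sqrt v).
  { intros u v ->; rewrite sqrt_mult_alt, sqrt_pow2; [reflexivity|lra|nra]. }
  simpl scale; unfold ceva.
  f_equal; [f_equal|]; apply Hroot; ring.
Qed.

Lemma iter_ceva_even (n : nat) (p : real_or_infty) (T : triple) :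
  triangle T -> Nat.iter (2 * n) (ceva p) T = scale (gain p ^ n) T.
Proof.
  intros HT; induction n as [|n IH]; [now rewrite scale_1|].
  replace (2 * S n)%nat with (S (S (2 * n))) by lia.
  change (Nat.iter (S (S (2 * n))) (ceva p) T)
    with (ceva p (ceva p (Nat.iter (2 * n) (ceva p) T))).
  rewrite IH, ceva_twice, scale_scale; [reflexivity|].
  apply triangle_scale; [apply pow_lt, gain_pos|assumption].
Qed.

(** The gain takes every value from its minimum [3/4] on, so it suffices that
    the [n]-th root of [k] be at least [3/4]. *)
Lemma positive_is_gain_pow (k : R) :
  0 < k -> exists n p, gain p ^ n = k.
Proof.
  intros Hk.
  destruct (pow_lt_1_zero (3 / 4)) with (y := k) as (n & Hn); [|assumption|].
  { rewrite Rabs_right; lra. }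
  specialize (Hn (S n) (Nat.le_succ_diag_r n)).
  rewrite Rabs_right in Hn by (apply Rle_ge, pow_le; lra).
  set (t := Rpower k (/ INR (S n))).
  assert (Ht0 : 0 < t) by apply exp_pos.
  assert (Ht : t ^ S n = k).
  { rewrite <- Rpower_pow by assumption.
    unfold t; rewrite Rpower_mult, Rinv_l by (apply not_0_INR; discriminate).
    apply Rpower_1; assumption. }
  assert (Ht34 : 3 / 4 <= t).
  { destruct (Rle_or_lt (3 / 4) t) as [|Hlt]; [assumption|exfalso].
    assert (t ^ S n <= (3 / 4) ^ S n) by (apply pow_incr; lra); lra. }
  exists (S n), (Real (1 / 2 + sqrt (t - 3 / 4))).
  rewrite <- Ht; f_equal; unfold gain.
  assert (Hs := sqrt_sqrt (t - 3 / 4)); nra.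
Qed.

(** * Shapes *)

(** Two triples with the same sum and the same sum of squares correspond to
    numbers [psi] of equal modulus.  Clearing denominators in
    [omega^2 (r + omega) / (r + omega^2) * conj psi = psi'] gives
    [r (omega^2 conj psi - psi') = omega^2 psi' - conj psi], whose
    coordinates are the three equations for [r]; the hypotheses make them
    consistent, and their left sides vanish only in the case of the point at
    infinity. *)
Lemma moebius_parameter (A B C A' B' C' : R) :
  A + B + C = A' + B' + C' ->
  A ^ 2 + B ^ 2 + C ^ 2 = A' ^ 2 + B' ^ 2 + C' ^ 2 ->
  (C = A' /\ B = B' /\ A = C') \/
  exists r, r * (C - A') = B' - A /\
            r * (B - B') = C' - C /\
            r * (A - C') = A' - B.
Proof.
  intros HS HN.
  assert (Hcons : (B' - A) * (B - B') = (C' - C) * (C - A')).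
  { replace A' with (A + B + C - B' - C') in * by lra. nra. }
  destruct (Req_dec C A') as [HC|HC].
  - destruct (Req_dec B B') as [HB|HB]; [left; repeat split; lra|right].
    exists ((C' - C) / (B - B')).
    assert (E2 : (C' - C) / (B - B') * (B - B') = C' - C) by (field; lra).
    assert (E1 : B' - A = 0).
    { apply Rmult_eq_reg_r with (B - B'); [|lra].
      rewrite Hcons, HC; ring. }
    set (r := (C' - C) / (B - B')) in *.
    assert (E3 : r * (C - A') = 0) by (rewrite HC; ring).
    repeat split; try nra.
  - right; exists ((B' - A) / (C - A')).
    assert (E1 : (B' - A) / (C - A') * (C - A') = B' - A) by (field; lra).
    assert (E2 : (B' - A) / (C - A') * (B - B') = C' - C).
    { apply Rmult_eq_reg_r with (C - A'); [|lra].
      rewrite <- Hcons; field; lra. }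
    set (r := (B' - A) / (C - A')) in *.
    repeat split; try assumption.
    replace (A - C') with (- (C - A') - (B - B')) by lra.
    rewrite Rmult_minus_distr_l, Ropp_mult_distr_r_reverse; lra.
Qed.

(** [moebius_parameter] applies to the squares of the two triples once those of
    [T] are rescaled by [s] to have the same sum; Heron's polynomial then
    matches the sums of squares of these squares. *)
Lemma ceva_reaches_shape (T V : triple) :
  triangle T -> triangle V -> brocard_cot T = brocard_cot V ->
  exists p k, 0 < k /\ ceva p T = scale k V.
Proof.
  intros HT HV E.
  assert (ST := sum_squares_pos T HT); assert (SV := sum_squares_pos V HV).
  set (s := sum_squares V / sum_squares T).
  assert (Hs : 0 < s) by (apply Rdiv_lt_0_compat; assumption).
  assert (HS : s * sum_squares T = sum_squares V) by (unfold s; field; lra).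
  assert (HH : s ^ 2 * heron T = heron V).
  { unfold brocard_cot in E.
    assert (QT := sqrt_lt_R0 _ (proj2 HT)); assert (QV := sqrt_lt_R0 _ (proj2 HV)).
    assert (Hq : s * sqrt (heron T) = sqrt (heron V)).
    { apply Rmult_eq_reg_l with (sum_squares T / sqrt (heron T));
        [|apply Rgt_not_eq, Rdiv_lt_0_compat; assumption].
      rewrite E at 2; unfold s; field; lra. }
    rewrite <- (sqrt_sqrt (heron V)) by (apply Rlt_le, HV).
    rewrite <- Hq.
    rewrite <- (sqrt_sqrt (heron T)) at 1 by (apply Rlt_le, HT); ring. }
  clear E; clearbody s.
  destruct T as [[a b] c], V as [[a' b'] c'].
  rewrite !heron_sqr in HH; unfold sum_squares in HS.
  assert (HV0 := proj1 HV); destruct HV0 as (Ha' & Hb' & Hc').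
  assert (Hk : forall p, 0 < sqrt (gain p / s)).
  { intros p; apply sqrt_lt_R0, Rdiv_lt_0_compat; [apply gain_pos|assumption]. }
  assert (Hk2 : forall p, s * sqrt (gain p / s) ^ 2 = gain p).
  { intros p; rewrite pow2_sqrt; [field; lra|].
    apply Rlt_le, Rdiv_lt_0_compat; [apply gain_pos|assumption]. }
  assert (Hroot : forall p u v, 0 < u -> 0 < v -> s * u ^ 2 = gain p * v ^ 2 ->
                    u = sqrt (gain p / s) * v).
  { intros p u v Hu Hv Huv.
    specialize (Hk p); specialize (Hk2 p).
    apply Rsqr_inj; [lra|nra|].
    apply Rmult_eq_reg_l with s; [|lra].
    rewrite !Rsqr_pow2, Huv, Rpow_mult_distr, <- Rmult_assoc, Hk2.
    reflexivity. }
  destruct (moebius_parameter (s * a ^ 2) (s * b ^ 2) (s * c ^ 2)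
              (a' ^ 2) (b' ^ 2) (c' ^ 2)) as [(E1 & E2 & E3)|(r & E1 & E2 & E3)];
    [lra| |exists Infty|exists (Real r)].
  - (* Heron's formula reads [2 (A^2 + B^2 + C^2) = S^2 - 16 D^2]. *)
    assert (HS2 : (s * (a ^ 2 + b ^ 2 + c ^ 2)) ^ 2 = (a' ^ 2 + b' ^ 2 + c' ^ 2) ^ 2)
      by now rewrite HS.
    lra.
  - exists (sqrt (gain Infty / s)); split; [apply Hk|].
    destruct HT as ((Ha & Hb & Hc) & _).
    simpl ceva; unfold scale.
    f_equal; [f_equal|]; apply Hroot; try assumption; unfold gain; lra.
  - exists (sqrt (gain (Real r) / s)); split; [apply Hk|].
    destruct (ceva_real_squares r a b c HT)
      as (x & y & z & -> & (Hx0 & Hy0 & Hz0) & Hx & Hy & Hz).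
    unfold scale.
    set (A := a ^ 2) in *; set (B := b ^ 2) in *; set (C := c ^ 2) in *;
    set (A' := a' ^ 2) in *; set (B' := b' ^ 2) in *; set (C' := c' ^ 2) in *.
    assert (F1 := f_equal (Rmult r) E1).
    assert (F2 := f_equal (Rmult r) E2).
    assert (F3 := f_equal (Rmult r) E3).
    f_equal; [f_equal|]; apply Hroot; try assumption; unfold gain;
      fold A' B' C'; rewrite ?Hx, ?Hy, ?Hz; lra.
Qed.

(** * The characterization *)

Theorem theorem12p2 :
  forall T V : triple,
    oriented_triangle T -> ~ equilateral T ->
    oriented_triangle V -> ~ equilateral V ->
    (same_brocard_angle T V <->
     exists (n0 : nat) (rho xi : real_or_infty),
       directly_congruent (ceva rho (Nat.iter (2 * n0) (ceva xi) T)) V).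
Proof.
  intros T V HT _ HV _.
  apply oriented_triangle_triangle in HT, HV.
  rewrite same_brocard_angle_iff by assumption.
  split.
  - intros E.
    destruct (ceva_reaches_shape T V HT HV E) as (rho & k & Hk & Hrho).
    destruct (positive_is_gain_pow (/ k)) as (n & xi & Hn);
      [apply Rinv_0_lt_compat, Hk|].
    exists n, rho, xi.
    rewrite iter_ceva_even, Hn, ceva_scale, Hrho, scale_scale, Rinv_l, scale_1
      by (assumption || lra || apply Rinv_0_lt_compat, Hk).
    destruct V as [[a b] c]; left; reflexivity.
  - intros (n & rho & xi & HC).
    apply brocard_cot_directly_congruent in HC.
    destruct (iter_ceva_invariant (2 * n) xi T HT) as [H1 H2].
    rewrite HC, brocard_cot_ceva; auto.
Qed.
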